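(* Let $f:\mathbb{R}\to\mathbb{C}$ be a 1-periodic function whose Fourier series $f(x)=\sum_{k\in\mathbb{Z}} c_k e^{2\pi i k x}$ converges absolutely (i.e. $\sum_{k\in\mathbb{Z}}|c_k|<\infty$). Then for every integer $P\ge 2$ the bias $B_P[f]=I_P[f]-I[f]$ of the $P$-point composite trapezoidal rule is given by $$B_P[f]=\sum_{k\in\mathbb{Z}\setminus\{0\}} c_k\,\tilde{\chi}_P\!\left(\frac kP\right),$$ where $\tilde{\chi}_P(y)=\frac1P\sum_{j=0}^{P-1}e^{2\pi i y j}$.
   Context: The Fourier coefficients are $c_k=\int_0^1 f(x)e^{-2\pi i k x}\,dx$, and $f(x)$ equals the sum of its Fourier series for every $x\in\mathbb{R}$. The exact integral is $I[f]=\int_0^1 f(x)\,dx=c_0$. The $P$-point composite trapezoidal rule is $I_P[f]=\frac1P\sum_{j=0}^{P-1} f\!\left(\frac jP\right)$. The complex resonance function is $\tilde{\chi}_P(y)=\frac1P\sum_{j=0}^{P-1}e^{2\pi i y j}$ for $y\in\mathbb{R}$. *)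

(* Defs.v *)
From Stdlib Require Import Reals ZArith List.
From Coquelicot Require Import Coquelicot.
Open Scope R_scope.

(* Unordered summation: the partial sum over a finite set of indices (a
   duplicate-free list) converges along the directed set of finite subsets
   of [D]. *)
Definition finite_subsets {I : Type} (D : I -> Prop) (Q : list I -> Prop) : Prop :=
  exists s0 : list I,
    NoDup s0 /\ List.Forall D s0 /\
    forall s : list I, NoDup s -> List.Forall D s -> incl s0 s -> Q s.

Definition is_sum {K : AbsRing} {V : NormedModule K} {I : Type}
    (D : I -> Prop) (a : I -> V) (l : V) : Prop :=
  filterlim (fun s : list I => Iter.iter plus zero s a)
    (finite_subsets D) (locally l).

Definition all_Z (k : Z) : Prop := True.
Definition nonzero_Z (k : Z) : Prop := k <> 0%Z.

Definition Cexp (z : C) : C := (exp (Re z) * (cos (Im z), sin (Im z)))%C.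

Definition integral (f : R -> C) : C :=
  RInt (V := C_R_CompleteNormedModule) f 0 1.

Definition fourier_coef (f : R -> C) (k : Z) : C :=
  integral (fun x => (f x * Cexp (- (2 * PI * Ci * IZR k * x)))%C).

(* Coquelicot's [RInt] is total and unspecified on non-integrable functions.
   This is harmless here: a function satisfying both conditions is the uniform
   limit of continuous functions, so every integral involved exists. *)
Definition abs_convergent_fourier (f : R -> C) : Prop :=
  (exists S : R, is_sum all_Z (fun k => Cmod (fourier_coef f k)) S) /\
  (forall x : R,
     is_sum all_Z (fun k => (fourier_coef f k * Cexp (2 * PI * Ci * IZR k * x))%C)
       (f x)).

(* [sum_n a n] is a 0 + ... + a n, with n+1 terms. *)
Definition trapezoidal (P : nat) (f : R -> C) : C :=
  (/ INR P * sum_n (fun j => f (INR j / INR P)%R) (P - 1))%C.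

Definition bias (P : nat) (f : R -> C) : C := (trapezoidal P f - integral f)%C.

Definition resonance (P : nat) (y : R) : C :=
  (/ INR P * sum_n (fun j => Cexp (2 * PI * Ci * y * INR j)) (P - 1))%C.

(* Main.v *)
Require Import Defs.
From Stdlib Require Import Reals ZArith List Lia.
From Coquelicot Require Import Coquelicot.
Open Scope R_scope.

(** On the grid point [j/P] the Fourier series of [f] is
    [sum_k c_k e^(2 pi i k j/P)].  Unordered sums are linear, so averaging these
    [P] series over [j] moves the average inside the sum and replaces the
    exponential by [resonance P (k/P)]: this gives the trapezoidal rule as a sum
    over all integers [k] ([is_sum_trapezoidal]).  The term [k = 0] equals
    [c_0], because the resonance at [0] is [1], and [c_0] is the exact integral.
    Deleting this one index ([is_sum_delete]) leaves the bias. The rest is the linearity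
    of limits along the directed set of finite subsets. *)

(** Two finite subsets have an upper bound, their union; deciding equality
    makes it possible to list the union without repetition. *)
Lemma finite_subsets_filter {I : Type} (eq_dec : forall i j : I, {i = j} + {i <> j})
    (D : I -> Prop) : Filter (finite_subsets D).
Proof.
  constructor.
  - exists nil. repeat split; auto using NoDup_nil.
  - intros Q1 Q2 (s1 & N1 & F1 & H1) (s2 & N2 & F2 & H2).
    exists (nodup eq_dec (s1 ++ s2)). split; [apply NoDup_nodup | split].
    + apply Forall_forall. intros i Hi. apply nodup_In, in_app_or in Hi.
      destruct Hi as [Hi | Hi]; [revert F1 | revert F2];
        rewrite Forall_forall; auto.
    + intros s N F Hs.
      split; [apply H1 | apply H2]; auto; intros i Hi; apply Hs, nodup_In,
        in_or_app; auto.
  - intros Q1 Q2 HQ (s0 & N & F & H). exists s0. repeat split; auto.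
Qed.

Lemma plus_opp_plus {G : AbelianGroup} (x y : G) : plus (opp x) (plus x y) = y.
Proof.
  now rewrite plus_assoc, plus_opp_l, plus_zero_l.
Qed.

Lemma iter_plus_add {G : AbelianMonoid} {I : Type} (a b : I -> G) (s : list I) :
  Iter.iter plus zero s (fun i => plus (a i) (b i)) =
  plus (Iter.iter plus zero s a) (Iter.iter plus zero s b).
Proof.
  induction s as [| i s IH]; simpl.
  - now rewrite plus_zero_l.
  - rewrite IH, <- !plus_assoc. f_equal.
    now rewrite !plus_assoc, (plus_comm (b i)).
Qed.

Lemma iter_plus_scal {K : Ring} {V : ModuleSpace K} {I : Type}
    (x : K) (a : I -> V) (s : list I) :
  Iter.iter plus zero s (fun i => scal x (a i)) =
  scal x (Iter.iter plus zero s a).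
Proof.
  induction s as [| i s IH]; simpl.
  - symmetry. exact (scal_zero_r x).
  - rewrite scal_distr_l. exact (f_equal (plus _) IH).
Qed.

Section UnorderedSums.

Context {K : AbsRing} {V : NormedModule K} {I : Type}
  (eq_dec : forall i j : I, {i = j} + {i <> j}).
Implicit Types (D : I -> Prop) (a b : I -> V).

(** Type-class resolution cannot produce the decision procedure by itself, so
    it is fixed here. *)
#[local] Instance finite_subsets_filter_eq_dec D : Filter (finite_subsets D) :=
  finite_subsets_filter eq_dec D.

Lemma is_sum_ext D a b (l : V) :
  (forall i, a i = b i) -> is_sum D a l -> is_sum D b l.
Proof.
  intros Hab. apply filterlim_ext. intros s. apply Iter.iter_ext. auto.
Qed.

Lemma is_sum_plus D a b (la lb : V) :
  is_sum D a la -> is_sum D b lb ->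
  is_sum D (fun i => plus (a i) (b i)) (plus la lb).
Proof.
  intros Ha Hb.
  apply filterlim_ext with
    (fun s => plus (Iter.iter plus zero s a) (Iter.iter plus zero s b)).
  - intros s. symmetry. apply iter_plus_add.
  - eapply filterlim_comp_2; [exact Ha | exact Hb | apply filterlim_plus].
Qed.

Lemma is_sum_scal D (x : K) a (l : V) :
  is_sum D a l -> is_sum D (fun i => scal x (a i)) (scal x l).
Proof.
  intros Ha.
  apply filterlim_ext with (fun s => scal x (Iter.iter plus zero s a)).
  - intros s. symmetry. exact (iter_plus_scal x a s).
  - eapply filterlim_comp; [exact Ha | apply filterlim_scal_r].
Qed.

Lemma is_sum_sum_n D (a : nat -> I -> V) (l : nat -> V) (n : nat) :
  (forall j, is_sum D (a j) (l j)) ->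
  is_sum D (fun i => sum_n (fun j => a j i) n) (sum_n l n).
Proof.
  intros H. induction n as [| n IH].
  - rewrite sum_O. apply is_sum_ext with (a 0%nat); auto.
    intros i. now rewrite sum_O.
  - rewrite sum_Sn.
    apply is_sum_ext with
      (fun i => plus (sum_n (fun j => a j i) n) (a (S n) i)).
    + intros i. now rewrite sum_Sn.
    + apply is_sum_plus; auto.
Qed.

(** Adding [i0] to a finite subset of [D'] gives a finite subset of [D], and the
    sets so obtained are cofinal; on them the sums over [D] and over [D'] differ
    by the constant [a i0]. *)
Lemma is_sum_delete D (D' : I -> Prop) (i0 : I) a (l : V) :
  (forall i, D i <-> i = i0 \/ D' i) -> ~ D' i0 ->
  is_sum D a l -> is_sum D' a (plus (opp (a i0)) l).
Proof.
  intros HD Hi0 Ha.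
  apply filterlim_ext with
    (fun s => plus (opp (a i0)) (Iter.iter plus zero (i0 :: s) a)).
  { intros s. exact (plus_opp_plus _ _). }
  eapply filterlim_comp_2;
    [apply filterlim_const | | apply filterlim_plus].
  apply (filterlim_comp _ _ _ (cons i0) (fun s => Iter.iter plus zero s a)
    _ (finite_subsets D)); [| exact Ha].
  intros Q (s0 & N0 & F0 & H0).
  (* [s0] may already contain [i0], which [cons i0] puts back. *)
  exists (filter (fun i => if eq_dec i i0 then false else true) s0).
  split; [now apply NoDup_filter | split].
  - apply Forall_forall. intros i Hi. apply filter_In in Hi.
    destruct Hi as [Hi Hne]. destruct (eq_dec i i0) as [| ne]; [discriminate |].
    rewrite Forall_forall in F0. apply F0, HD in Hi. tauto.
  - intros s N F Hs. apply H0.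
    + constructor; auto. intros Hin. rewrite Forall_forall in F.
      now apply Hi0, F.
    + constructor; [apply HD; auto |].
      revert F. apply Forall_impl. intros i Hi. apply HD. auto.
    + intros i Hi. destruct (eq_dec i i0) as [-> | ne]; [now left | right].
      apply Hs, filter_In. split; auto. now destruct (eq_dec i i0).
Qed.

End UnorderedSums.

Lemma Cexp_0 : Cexp 0 = 1%C.
Proof.
  unfold Cexp. simpl. rewrite exp_0, cos_0, sin_0. apply Cmult_1_l.
Qed.

Lemma fourier_coef_0 (f : R -> C) : fourier_coef f 0 = integral f.
Proof.
  unfold fourier_coef, integral. apply (RInt_ext (V := C_R_CompleteNormedModule)).
  intros x _.
  replace (- (2 * PI * Ci * 0 * x))%C with (RtoC 0) by ring.
  rewrite Cexp_0. apply Cmult_1_r.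
Qed.

Lemma sum_n_C1 (n : nat) :
  sum_n (G := C_AbelianMonoid) (fun _ => RtoC 1) n = RtoC (INR (S n)).
Proof.
  induction n as [| n IH].
  - now rewrite sum_O.
  - rewrite sum_Sn, IH, (S_INR (S n)), RtoC_plus. reflexivity.
Qed.

Lemma resonance_0 (P : nat) : (P <> 0)%nat -> resonance P 0 = 1%C.
Proof.
  intros HP. unfold resonance.
  rewrite (sum_n_ext _ (fun _ => RtoC 1)).
  - rewrite sum_n_C1. replace (S (P - 1)) with P by lia.
    apply Cinv_l. intros E. apply RtoC_inj in E. now apply (not_0_INR P).
  - intros j. rewrite <- Cexp_0. f_equal. ring.
Qed.

(** The [P] series at the grid points are limits along the same directed set, so
    their average is the sum of the averaged terms, and
    [(k/P) j = k (j/P)] identifies the averaged exponential as the resonance. *)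
Lemma is_sum_trapezoidal (f : R -> C) (c : Z -> C) (P : nat) :
  (forall x : R, is_sum (V := C_NormedModule) all_Z
     (fun k => (c k * Cexp (2 * PI * Ci * IZR k * x))%C) (f x)) ->
  is_sum (V := C_NormedModule) all_Z
    (fun k => (c k * resonance P (IZR k / INR P)%R)%C) (trapezoidal P f).
Proof.
  intros Hf.
  pose proof (is_sum_sum_n Z.eq_dec all_Z _ _ (P - 1)
    (fun j => Hf (INR j / INR P)%R)) as H.
  apply (is_sum_scal Z.eq_dec all_Z (/ INR P)%C) in H.
  revert H. apply (is_sum_ext Z.eq_dec). intros k. unfold resonance.
  rewrite (sum_n_ext _ (fun j => mult (c k)
    (Cexp (2 * PI * Ci * (IZR k / INR P)%R * INR j)))).
  - rewrite (sum_n_mult_l (K := C_Ring)).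
    change (/ INR P * (c k * sum_n (fun j =>
      Cexp (2 * PI * Ci * (IZR k / INR P)%R * INR j)) (P - 1)) =
      c k * (/ INR P * sum_n (fun j =>
      Cexp (2 * PI * Ci * (IZR k / INR P)%R * INR j)) (P - 1)))%C.
    ring.
  - intros j. change mult with Cmult. do 2 f_equal.
    unfold Rdiv. rewrite !RtoC_mult. ring.
Qed.

Theorem theorem5p1 (f : R -> C)
    (f_periodic : forall x : R, f (x + 1) = f x)
    (f_fourier : abs_convergent_fourier f)
    (P : nat) (P_ge2 : (2 <= P)%nat) :
  is_sum nonzero_Z
    (fun k : Z => (fourier_coef f k * resonance P (IZR k / INR P)%R)%C)
    (bias P f).
Proof.
  assert (HP : (P <> 0)%nat) by lia.
  pose proof (is_sum_trapezoidal f (fourier_coef f) P (proj2 f_fourier)) as H.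
  apply (is_sum_delete Z.eq_dec all_Z nonzero_Z 0%Z) in H.
  - replace (bias P f) with
      (plus (opp (fourier_coef f 0 * resonance P (IZR 0 / INR P)%R)%C)
         (trapezoidal P f)); [exact H |].
    unfold Rdiv. rewrite Rmult_0_l, resonance_0, fourier_coef_0 by exact HP.
    change (- (integral f * 1) + trapezoidal P f = bias P f)%C.
    unfold bias. ring.
  - intros k. unfold all_Z, nonzero_Z. destruct (Z.eq_dec k 0); tauto.
  - unfold nonzero_Z. tauto.
Qed.
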